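(* Let $I\subseteq\mathbb{R}$ be an interval with interior $I^\circ$, let $f:I^\circ\to\mathbb{R}$ be a twice differentiable function on $I^\circ$, and let $a,b\in I$ with $a<b$ and $f''\in L^1[a,b]$. If the mapping $|f''|$ is $(h-(\alpha,m))$-convex on $[a,b]$, then $$\left|\frac{f(a)+f(b)}{2}-\frac{1}{b-a}\int_a^b f(x)\,dx\right|\le \frac{(b-a)^2}{2}\left[\left\{|f''(a)|-m\left|f''\left(\frac bm\right)\right|\right\}\int_0^1t(1-t)h^\alpha(t)\,dt+\frac m6\left|f''\left(\frac bm\right)\right|\right].$$
   Context: Notation: $h^\alpha(t)=(h(t))^\alpha$. Let $h:\mathcal{J}\subseteq\mathbb{R}\to\mathbb{R}$ be a non-negative function, $h\neq 0$, and let $(\alpha,m)\in[0,1]^2$. A function $g$ is $(h-(\alpha,m))$-convex on $D\subseteq\mathbb{R}$ if $g$ is non-negative and, for all $x,y\in D$ and $\lambda\in(0,1)$, $$g(\lambda x+m(1-\lambda)y)\le h^\alpha(\lambda)\,g(x)+m\,(1-h^\alpha(\lambda))\,g(y).$$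
   Formalization: The convexity of |f''| is required on [a,b] together with the point b/m, since with [a,b] alone the claim is false (a=0, b=1, m=1/2, h=id, f''(x)=x on [0,1], f''(2)=0); also m is nonzero and a, b, b/m lie in the interior of I, so that all terms are defined. *)

(* Defs.v *)
From HB Require Import structures.
From mathcomp Require Import all_boot all_order all_algebra.
From mathcomp Require Import all_classical all_reals all_analysis.
Set Implicit Arguments.
Unset Strict Implicit.
Unset Printing Implicit Defensive.
Import Order.TTheory GRing.Theory Num.Theory.
Import numFieldNormedType.Exports.
Local Open Scope ring_scope.
Local Open Scope classical_set_scope.

(* [h t `^ alpha] is [powR], with the convention 0 `^ 0 = 1.  The point
   [l * x + m * (1 - l) * y] need not lie in [D]: as in the usual definition,
   [g] is evaluated there nonetheless. *)
Definition h_alpha_m_convex (R : realType) (h : R -> R) (alpha m : R)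
    (D : set R) (g : R -> R) : Prop :=
  (forall x, D x -> 0 <= g x) /\
  (forall x y l : R, D x -> D y -> 0 < l < 1 ->
     g (l * x + m * (1 - l) * y) <=
       h l `^ alpha * g x + m * (1 - h l `^ alpha) * g y).

Definition twice_differentiable_on (R : realType) (U : set R) (f : R -> R) :
    Prop :=
  forall x, U x -> derivable f x 1 /\ derivable f^`() x 1.

(* Main.v *)
Require Import Defs.
From HB Require Import structures.
From mathcomp Require Import all_boot all_order all_algebra.
From mathcomp Require Import ring lra.
From mathcomp Require Import all_classical all_reals all_analysis.
From mathcomp Require Import measurable_realfun.
Set Implicit Arguments.
Unset Strict Implicit.
Unset Printing Implicit Defensive.
Import Order.TTheory GRing.Theory Num.Theory.
Import numFieldNormedType.Exports.
Local Open Scope ring_scope.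
Local Open Scope classical_set_scope.

(** The trapezoidal error of [f] on [[a, b]] is the integral of [f''] against
    the parabola [(x - a) * (b - x)], up to the factor [1 / (2 * (b - a))].
    After the substitution [x = t * a + (1 - t) * b] it is bounded by
    [(b - a)^2 / 2] times the integral over [[0, 1]] of
    [t * (1 - t) * |f''(t * a + (1 - t) * b)|].  Convexity at the two points
    [a] and [b / m] replaces [|f''|] there by the affine function
    [D * h(t)^alpha + C] of [h(t)^alpha], where [C = m * |f''(b / m)|] and
    [D = |f''(a)| - C]; since [t * (1 - t)] has integral [1 / 6], the bound
    follows.  Two points need care.

    The second derivative is only assumed integrable, not continuous, so the
    identity for the error rests on the fundamental theorem of calculus in its
    sharp form: a function differentiable at every point of [[a, b]], with
    integrable derivative, is the integral of its derivative
    ([Rintegral_derivative]).  Let [H] be the difference between the function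
    and the indefinite integral of its derivative.  At Lebesgue points [H] has
    derivative [0]; the remaining points form a null set, above which an
    integrable weight [w] can be built that, near each of them, dominates any
    given multiple of [1 + |derivative|] ([integrable_weight_over_null_set]).
    Hence, for each [e > 0], adding [e * (x + \int_a^x w)] to [H] or to [- H]
    gives a function that is nondecreasing around each point, therefore
    nondecreasing ([locally_increasing_le]); letting [e] tend to [0], [H] takes
    equal values at [a] and [b].  The error identity is this theorem for the
    single primitive
    [(x - a) * (b - x) * f'(x) - (a + b - 2 * x) * f(x)].

    The function [h] is arbitrary, so [t * (1 - t) * h(t)^alpha] may fail to be
    measurable; its integral is then a supremum over the simple functions below
    it.  It is still monotone ([le_integral_nonmeasurable]), and solving the
    convexity inequality for [h(t)^alpha] compares it with a measurable
    function, from below or from above according to the sign of [D]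
    ([integral_le_affine]). *)

(** * From local to global monotonicity *)

(** The hypothesis compares [P] at [x] with [P] at nearby points on either
    side, with a neighbourhood that depends on [x] without uniformity.  The
    supremum of the points where [P] is at least [P a] is such a point, and
    cannot be less than [b]. *)
Lemma locally_increasing_le (R : realType) (P : R -> R) (a b : R) : a <= b ->
  (forall x, a <= x <= b -> \forall y \near x, a <= y <= b ->
     (x <= y -> P x <= P y) /\ (y <= x -> P y <= P x)) ->
  P a <= P b.
Proof.
move=> ab Ploc.
pose S := [set x | a <= x <= b /\ P a <= P x].
have Sa : S a by rewrite /S/= lexx ab.
have Sb : ubound S b by move=> x [/andP[]].
have supS : has_sup S by split; [exists a | exists b].
set s := sup S.
have as_ : a <= s by apply: ub_le_sup => //; exists b.
have sb : s <= b by apply: ge_sup => //; exists a.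
have asb : a <= s <= b by rewrite as_ sb.
have [e /= e0 Pe] := Ploc s asb.
have Ss : P a <= P s.
  have [x [/andP[ax xb] Pax] sx] := sup_adherent e0 supS.
  have xs : x <= s by apply: ub_le_sup; [exists b | split; rewrite ?ax].
  have sex : ball s e x.
    by rewrite /ball/= ger0_norm ?subr_ge0// ltrBlDr addrC -ltrBlDr.
  have axb : a <= x <= b by rewrite ax xb.
  by have [_ Pxs] := Pe x sex axb; rewrite (le_trans Pax)// Pxs.
move: sb; rewrite le_eqVlt => /predU1P[<-//|sb].
(* a point just to the right of the supremum, which would belong to S *)
pose y := Num.min b (s + e / 2).
have sy : s < y by rewrite lt_min sb ltrDl divr_gt0.
have yb : y <= b by rewrite ge_min lexx.
have ayb : a <= y <= b by rewrite yb (le_trans as_ (ltW sy)).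
have ye : ball s e y.
  rewrite /ball/= distrC ger0_norm ?subr_ge0 ?(ltW sy)// ltrBlDl.
  by rewrite (@le_lt_trans _ _ (s + e / 2)) ?ge_min ?lexx ?orbT// ltrD2l; lra.
have [Psy _] := Pe y ye ayb.
suff : y <= s by rewrite leNgt sy.
by apply: ub_le_sup; [exists b | split => //; rewrite (le_trans Ss)// Psy// ltW].
Qed.

(** * Integrals of non-measurable functions *)

(** A simple function below [f] is below [g], and the integral of a nonnegative
    function is a supremum over such functions, whether or not it is
    measurable. *)
Lemma le_integral_nonmeasurable d (T : measurableType d) (R : realType)
    (mu : {measure set T -> \bar R}) (D : set T) (f g : T -> \bar R) :
  (forall x, D x -> 0 <= f x)%E -> (forall x, D x -> f x <= g x)%E ->
  (\int[mu]_(x in D) f x <= \int[mu]_(x in D) g x)%E.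
Proof.
move=> f0 fg.
rewrite !ge0_integralE//; last by move=> x Dx; exact: le_trans (f0 _ Dx) (fg _ Dx).
apply: le_ereal_sup => _ [h /= hf <-]; exists h => // x.
apply: le_trans (hf x) _.
by rewrite !patchE; case: ifPn => // /set_mem; exact: fg.
Qed.

(** Only [k] and [v] are measurable.  For [c > 0], [u] lies above the measurable
    function [max 0 ((k - v) / c)]; for [c < 0], it lies below the integrable
    function [(v - k) / - c], so that its integral is finite. *)
Lemma integral_le_affine d (T : measurableType d) (R : realType)
    (mu : {measure set T -> \bar R}) (D : set T) (c : R) (k u v : T -> R) :
  measurable D -> measurable_fun D k ->
  (forall x, D x -> 0 <= k x) -> (forall x, D x -> 0 <= u x) ->
  (forall x, D x -> 0 <= v x) ->
  mu.-integrable D (EFin \o v) ->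
  (forall x, D x -> k x <= c * u x + v x) ->
  (\int[mu]_(x in D) (k x)%:E <=
     c%:E * \int[mu]_(x in D) (u x)%:E + \int[mu]_(x in D) (v x)%:E)%E.
Proof.
move=> mD mk k0 u0 v0 iv kuv.
have mv : measurable_fun D v by exact/measurable_EFinP/(measurable_int mu).
have [c0|c0|c0] := ltgtP c 0.
- have u_le x : D x -> u x <= (- c)^-1 * (v x - k x).
    by move=> Dx; rewrite ler_pdivlMl ?oppr_gt0//; have := kuv _ Dx; lra.
  have k_le x : D x -> k x <= v x.
    by move=> Dx; have := kuv _ Dx; have := u0 _ Dx; nra.
  have ik : mu.-integrable D (EFin \o k).
    apply: le_integrable iv => //; first exact/measurable_EFinP.
    by move=> x Dx /=; rewrite lee_fin !ger0_norm ?k0 ?v0 ?k_le.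
  have ivk : mu.-integrable D (EFin \o (fun x => v x - k x)).
    by rewrite (_ : _ \o _ = (EFin \o v) \- (EFin \o k))%E//; exact: integrableB.
  have : (\int[mu]_(x in D) (u x)%:E <=
          (- c)^-1%:E * (\int[mu]_(x in D) (v x)%:E - \int[mu]_(x in D) (k x)%:E))%E.
    rewrite -integralB_EFin// -integralZl//.
    by apply: le_integral_nonmeasurable => x Dx; rewrite lee_fin ?u0 ?u_le.
  have : (0 <= \int[mu]_(x in D) (u x)%:E)%E by apply: integral_ge0 => x /u0.
  move: (integrable_fin_num mD iv) (integrable_fin_num mD ik) => /=.
  case: (\int[mu]_(x in D) (v x)%:E)%E => // V _.
  case: (\int[mu]_(x in D) (k x)%:E)%E => // K _.
  case: (\int[mu]_(x in D) (u x)%:E)%E => // U.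
  rewrite -EFinB -!EFinM -!EFinD !lee_fin => U0.
  by rewrite ler_pdivlMl ?oppr_gt0//; lra.
- pose r x : R := Num.max 0 (c^-1 * (k x - v x)).
  have r0 x : D x -> 0 <= r x by move=> _; rewrite le_max lexx.
  have mr : measurable_fun D r.
    apply: measurable_maxr => //; apply: measurable_funM => //.
    exact: measurable_funB.
  have r_le x : D x -> r x <= u x.
    move=> Dx; rewrite ge_max u0//= ler_pdivrMl//; have := kuv _ Dx; lra.
  have : (\int[mu]_(x in D) (k x)%:E <=
          c%:E * \int[mu]_(x in D) (r x)%:E + \int[mu]_(x in D) (v x)%:E)%E.
    rewrite -ge0_integralZl ?lee_fin ?(ltW c0)//; last exact/measurable_EFinP.
    rewrite -ge0_integralD//; first last.
    - exact/measurable_EFinP.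
    - by apply/measurable_EFinP; exact: measurable_funM.
    - by move=> x Dx; rewrite mule_ge0// lee_fin ?r0// ltW.
    apply: le_integral_nonmeasurable => x Dx; rewrite lee_fin ?k0//.
    rewrite -lerBlDr -ler_pdivrMl// le_max lexx orbT//.
  move=> /le_trans; apply; rewrite leeD2r// lee_pmul2l//.
  by apply: le_integral_nonmeasurable => x Dx; rewrite lee_fin ?r0 ?r_le.
- rewrite c0 mul0e add0e; apply: le_integral_nonmeasurable => x Dx.
  by rewrite lee_fin k0.
  by rewrite lee_fin (le_trans (kuv _ Dx))// c0 mul0r add0r.
Qed.

(** * Affine change of variable on a segment *)

(** Since [g] is merely measurable, the substitution is made on measures:
    Lebesgue measure is [b - a] times its image under
    [t |-> t * a + (1 - t) * b], as both agree on half-open intervals. *)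
Lemma ge0_integral_segment (R : realType) (a b : R) (g : R -> \bar R) : a < b ->
  measurable_fun `[a, b] g -> (forall x : R, a <= x <= b -> (0 <= g x)%E) ->
  (\int[@lebesgue_measure R]_(x in `[a, b]) g x =
   (b - a)%:E * \int[@lebesgue_measure R]_(t in `[0%R, 1%R])
                   g (t * a + (1 - t) * b)%R)%E.
Proof.
move=> ab mg g0.
have ba : 0 < b - a by rewrite subr_gt0.
pose phi (t : R) : measurableTypeR R := t * a + (1 - t) * b.
have mphi : measurable_fun [set: measurableTypeR R] phi.
  apply: measurable_funD; first exact: measurable_funM.
  by apply: measurable_funM => //; exact: measurable_funB.
pose k := NngNum (ltW ba).
(* the map reverses orientation: preimages of ]c, d] are closed on the left *)
have preim (c d : R) (t : R) : (c < phi t <= d) =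
    ((b - d) / (b - a) <= t < (b - c) / (b - a)).
  rewrite ler_pdivrMr// ltr_pdivlMr// andbC /phi.
  by congr (_ && _); [rewrite -subr_ge0 -[RHS]subr_ge0
    | rewrite -subr_gt0 -[RHS]subr_gt0]; congr (_ _ _); ring.
have lebE A : measurable A ->
    lebesgue_measure A = mscale k (pushforward lebesgue_measure phi) A.
  apply: lebesgue_measure_unique => _ [[c d] _ <-].
  rewrite /= /mscale/= /pushforward.
  rewrite (_ : phi @^-1` _ =
      `[(b - d) / (b - a), (b - c) / (b - a)[%classic); last first.
    by apply/seteqP; split => t /=; rewrite !in_itv/= preim.
  rewrite !lebesgue_measure_itv/= !lte_fin ltr_pM2r ?invr_gt0// ltrD2l ltrN2.
  case: ifPn => cd; last by rewrite mule0.
  by rewrite -!EFinB -EFinM; congr EFin; field; rewrite gt_eqF.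
rewrite (eq_measure_integral (mscale k (pushforward lebesgue_measure phi))); last first.
  by move=> A mA _; exact: lebE.
rewrite ge0_integral_mscale//; congr (_ * _)%E.
rewrite ge0_integral_pushforward//; last first.
  by move=> x; rewrite inE/= in_itv/=; exact: g0.
congr (integral _ _ _); apply/seteqP; split => t /=; rewrite !in_itv/= /phi.
- move=> /andP[h1 h2]; apply/andP; split; nra.
- move=> /andP[h1 h2]; apply/andP; split; nra.
Qed.

(** * The fundamental theorem of calculus for integrable derivatives *)

(** Outer regularity and absolute continuity of the integral give open sets
    [U_j] containing [N] on which [q] has integral at most [1 / 2^(j+1)].  The
    sum of the [q * 1_(U_j)] has integral at most [1] and is at least [n * q] on
    the intersection of the first [n] sets, a neighbourhood of each point of
    [N]. *)
Lemma integrable_weight_over_null_set (R : realType) (q : R -> R) (N : set R) :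
  (forall x, 0 <= q x) ->
  (@lebesgue_measure R).-integrable setT (EFin \o q) ->
  (@lebesgue_measure R).-negligible N ->
  exists w : R -> \bar R,
    [/\ measurable_fun setT w, forall x, (0 <= w x)%E,
        (\int[@lebesgue_measure R]_x w x < +oo)%E &
        forall x (n : nat), N x ->
          \forall y \near x, ((n%:R * q y)%:E <= w y)%E].
Proof.
move=> q0 iq /negligible_outer_measure N0.
have exU (j : nat) : exists U : set R, [/\ open U, N `<=` U &
    (\int[@lebesgue_measure R]_(x in U) (q x)%:E <= (1 / (2 ^ j.+1)%:R)%:E)%E].
  have e0 : 0 < 1 / (2 ^ j.+1)%:R :> R by rewrite divr_gt0// ltr0n expn_gt0.
  have [d [d0 dq]] := integral_normr_continuous iq e0.
  have d20 : 0 < d / 2 by rewrite divr_gt0.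
  have [U [oU NU Ud]] := outer_measure_open_le N d20.
  exists U; split => //.
  have mU : measurable U by exact: open_measurable.
  have iqU : (@lebesgue_measure R).-integrable U (EFin \o q).
    by apply: integrableS iq.
  rewrite -[leLHS]fineK; last exact: integrable_fin_num iqU.
  rewrite lee_fin; apply: ltW.
  have : \int[@lebesgue_measure R]_(x in U) `|q x| < 1 / (2 ^ j.+1)%:R.
    apply: dq => //; apply: le_lt_trans Ud _.
    by rewrite N0 add0e lte_fin; lra.
  by under eq_Rintegral do rewrite ger0_norm ?q0//.
have [U Uj] := choice exU.
have mU j : measurable (U j) by have [oU _ _] := Uj j; exact: open_measurable.
have mq : measurable_fun setT q by apply/measurable_EFinP; exact: measurable_int iq.
pose g j y : \bar R := (q y * \1_(U j) y)%:E.
have g0 j y : (0 <= g j y)%E by rewrite lee_fin mulr_ge0.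
have mg j : measurable_fun setT (g j).
  by apply/measurable_EFinP; apply: measurable_funM => //; exact: measurable_indic.
exists (fun y => \sum_(0 <= j <oo) g j y)%E; split.
- exact: ge0_emeasurable_sum.
- by move=> x; exact: nneseries_ge0.
- rewrite integral_nneseries//.
  apply: (@le_lt_trans _ _ (\sum_(0 <= j <oo) (1 / (2 ^ j.+1)%:R)%:E)%E).
    apply: lee_nneseries => [j _ _|j _]; first by apply: integral_ge0.
    have [_ _] := Uj j; apply: le_trans.
    rewrite [leRHS]integral_mkcond.
    apply: le_integral_nonmeasurable => x _ //.
    by rewrite /g patchE indicE; case: ifPn => _; rewrite ?mulr1 ?mulr0.
  by apply: le_lt_trans (epsilon_trick0 _ _) _; rewrite ?ltry.
- move=> x n Nx.
  have : \forall y \near x, forall j, (j < n)%N -> U j y.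
    elim: n => [|n IH]; first by near=> y.
    near=> y => j; rewrite ltnS leq_eqVlt => /predU1P[->|jn].
      near: y; have [oU NU _] := Uj n.
      by apply: open_nbhs_nbhs; split => //; exact: NU.
    by move: j jn; near: y.
  apply: filterS => y Uy.
  apply: le_trans (nneseries_lim_ge n _) => //.
  rewrite big_mkord (eq_bigr (fun=> (q y)%:E)).
    by rewrite sumEFin sumr_const card_ord mulr_natl.
  by move=> i _; rewrite /g indicE mem_set ?mulr1//; exact: Uy.
Unshelve. all: by end_near. Qed.

Lemma is_derive_near_le (R : realType) (G : R -> R) (x l : R) :
  is_derive x 1 G l -> forall e, 0 < e ->
  \forall y \near x, `|G y - G x - l * (y - x)| <= e * `|y - x|.
Proof.
move=> [dG Gl] e e0.
have /cvgrPdist_le/(_ e e0)[r /= r0 rG] : h^-1 *: (G (h *: 1 + x) - G x) @[h --> 0^'] --> l.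
  by rewrite -Gl; exact: dG.
exists r => //= y xy; have [->|yx] := eqVneq y x.
  by rewrite !subrr mulr0 subrr !normr0 mulr0.
have yx0 : y - x != 0 by rewrite subr_eq0.
have yx_r : ball 0 r (y - x) by rewrite /ball/= sub0r normrN distrC.
have := rG (y - x) yx_r yx0.
rewrite [_ *: 1]mulr1 subrK => {}rG.
have -> : G y - G x - l * (y - x) = ((y - x)^-1 * (G y - G x) - l) * (y - x).
  by field.
by rewrite normrM ler_wpM2r// distrC.
Qed.

(** The derivative may be unbounded and discontinuous, so that dominated
    convergence of difference quotients is not available.  Differentiability
    almost everywhere would not suffice, as the Cantor function shows. *)
Lemma Rintegral_derivative (R : realType) (F f : R -> R) (a b : R) : a < b ->
  (forall x : R, a <= x <= b -> is_derive x 1 F (f x)) ->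
  (@lebesgue_measure R).-integrable `[a, b] (EFin \o f) ->
  \int[@lebesgue_measure R]_(x in `[a, b]) f x = F b - F a.
Proof.
move=> ab dF intf.
have mab : measurable (`[a, b] : set R) by exact: measurable_itv.
pose p : R -> R := f \_ `[a, b].
have pE x : a <= x <= b -> p x = f x.
  by move=> xab; rewrite /p patchE mem_set//= in_itv.
have intp : lebesgue_measure.-integrable setT (EFin \o p).
  by rewrite /p -restrict_EFin; apply/(integrable_mkcond _ _).1.
have intpab : lebesgue_measure.-integrable `[a, b] (EFin \o p) by exact: integrableS intp.
(* the end points join the exceptional set, since the differentiation theorem for
   indefinite integrals needs points inside the segment *)
pose N := ~` [set x | lebesgue_pt p x] `|` ([set a] `|` [set b]).
have N0 : lebesgue_measure.-negligible N.
  apply: negligibleU.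
    by have := lebesgue_differentiation (integrable_locally mab intf).
  by apply: negligibleU; apply/negligibleP => //; exact: lebesgue_measure_set1.
(* the summand 1 makes multiples of q control constants as well as f *)
pose q : R -> R := (fun x => 1 + `|f x|) \_ `[a, b].
have qE x : a <= x <= b -> q x = 1 + `|f x|.
  by move=> xab; rewrite /q patchE mem_set//= in_itv.
have q0 x : 0 <= q x by rewrite /q patchE; case: ifPn => // _; rewrite addr_ge0.
have intq : lebesgue_measure.-integrable setT (EFin \o q).
  rewrite /q -restrict_EFin; apply/(integrable_mkcond _ _).1 => //.
  rewrite (_ : _ \o _ = (EFin \o cst (1%R : R)) \+ (fun x => `|(f x)%:E|))%E//.
  apply: integrableD => //; last exact: integrable_abse.
  apply: continuous_compact_integrable; first exact: segment_compact.
  by apply: continuous_subspaceT => x; exact: cvg_cst.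
have [w [mw w0 intw wN]] := integrable_weight_over_null_set q0 intq N0.
pose I x := \int[lebesgue_measure]_(t in `[a, x]) p t.
pose Phi x := fine (\int[lebesgue_measure]_(t in `[a, x]) w t)%E.
pose H x := F x - I x.
have IB u v : a <= u -> u <= v -> I v - I u = \int[lebesgue_measure]_(t in `]u, v]) p t.
  move=> au uv; rewrite /I Rintegral_itvB ?bnd_simp//.
  by apply: integrableS intp.
have PhiE x : ((Phi x)%:E = \int[lebesgue_measure]_(t in `[a, x]) w t)%E.
  rewrite fineK// ge0_fin_numE; last by apply: integral_ge0.
  apply: le_lt_trans intw; apply: ge0_subset_integral => //.
have PhiB u v : a <= u -> u <= v ->
    ((Phi v - Phi u)%:E = \int[lebesgue_measure]_(t in `]u, v]) w t)%E.
  move=> au uv.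
  have E : ((Phi v)%:E =
            (Phi u)%:E + \int[lebesgue_measure]_(t in `]u, v]) w t)%E.
    rewrite !PhiE -ge0_integral_setU//=; last 2 first.
    - exact: measurable_funS mw.
    - apply/disj_setPRL => t /=; rewrite !in_itv/= => /andP[ut _] /andP[_].
      by rewrite leNgt ut.
    congr integral.
    by rewrite -(@itv_bndbnd_setU _ _ (BLeft a) (BRight u) (BRight v))// ?bnd_simp.
  by rewrite EFinB E addeAC -EFinB subrr add0e.
have Phi_nd u v : a <= u -> u <= v -> Phi u <= Phi v.
  move=> au uv; rewrite -subr_ge0 -lee_fin PhiB//.
  by apply: integral_ge0.
(* on a segment where w dominates a large multiple of q, the increment of Phi
   absorbs those of F and of the integral *)
have absorb e C u v : 0 < e -> 1 <= C -> a <= u -> u <= v -> v <= b ->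
    (forall z, u <= z <= v -> ((C * q z)%:E <= e%:E * w z)%E) ->
    C * (v - u) + `|I v - I u| <= e * (Phi v - Phi u).
  move=> e0 C1 au uv vb Cq.
  have ipuv : lebesgue_measure.-integrable `]u, v] (EFin \o p) by exact: integrableS intp.
  have iauv : lebesgue_measure.-integrable `]u, v] (EFin \o (fun x => `|p x|)).
    by have := integrable_abse ipuv.
  apply: (@le_trans _ _ (C * (v - u) + \int[lebesgue_measure]_(t in `]u, v]) `|p t|)).
    by rewrite lerD2l IB//; exact: le_normr_Rintegral.
  rewrite -lee_fin EFinM PhiB// EFinD.
  have -> : (C * (v - u))%:E = (\int[lebesgue_measure]_(t in `]u, v]) (cst C%:E) t)%E.
    rewrite integral_cst//= lebesgue_measure_itv/= lte_fin.
    move: uv; rewrite le_eqVlt => /predU1P[->|->]; last by rewrite EFinM EFinB.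
    by rewrite ltxx subrr mulr0 mule0.
  rewrite /Rintegral fineK; last exact: integrable_fin_num iauv.
  rewrite -ge0_integralD//; last 2 first.
  - by move=> x _; rewrite lee_fin; lra.
  - exact: measurable_int iauv.
  rewrite -ge0_integralZl//; last 2 first.
  - exact: measurable_funS mw.
  - by rewrite lee_fin ltW.
  apply: le_integral_nonmeasurable => z /=; rewrite in_itv/= => /andP[uz zv].
    by rewrite lee_fin addr_ge0//; lra.
  have zab : a <= z <= b by apply/andP; split; lra.
  apply: le_trans (Cq z _); last by rewrite zv ltW.
  rewrite lee_fin pE// qE//; have := normr_ge0 (f z); nra.
(* Near an exceptional point x, the increment of F is at most |f x| + 1 times
   y - x in absolute value, and w absorbs it; elsewhere H has derivative 0. *)
have near_H e x : 0 < e -> a <= x <= b -> \forall y \near x, a <= y <= b ->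
    `|H y - H x| <= e * (`|y - x| + `|Phi y - Phi x|).
  move=> e0 /[dup] xab /andP[ax xb]; have [Nx|] := pselect (N x).
  - pose C := `|f x| + 1.
    have C1 : 1 <= C by rewrite lerDr.
    have Cn : C <= e * (Num.bound (C / e))%:R.
      rewrite mulrC -ler_pdivrMr//; apply/ltW/archi_boundP.
      by rewrite divr_ge0// ?(ltW e0)//; lra.
    have [r1 /= r10 wr1] := wN x (Num.bound (C / e)) Nx.
    have Cqw z : `|x - z| < r1 -> ((C * q z)%:E <= e%:E * w z)%E.
      move=> /wr1 qw; apply: (@le_trans _ _ (e%:E * ((Num.bound (C / e))%:R * q z)%:E)%E).
        by rewrite -EFinM lee_fin mulrA ler_wpM2r.
      by rewrite lee_pmul2l.
    have [r2 /= r20 Fr2] := is_derive_near_le (dF x xab) ltr01.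
    exists (Num.min r1 r2) => /=; first by rewrite lt_min r10.
    move=> y /=; rewrite lt_min => /andP[yr1 yr2] /andP[ay yb].
    have Fyx : `|F y - F x| <= C * `|y - x|.
      have -> : F y - F x = (F y - F x - f x * (y - x)) + f x * (y - x) by ring.
      apply: le_trans (ler_normD _ _) _.
      by rewrite /C mulrDl addrC lerD// ?normrM//; exact: Fr2.
    apply: (@le_trans _ _ (C * `|y - x| + `|I y - I x|)).
      have -> : H y - H x = (F y - F x) - (I y - I x) by rewrite /H; ring.
      by apply: le_trans (ler_normB _ _) _; rewrite lerD2r.
    apply: (@le_trans _ _ (e * `|Phi y - Phi x|)); last first.
      by rewrite ler_pM2l// lerDr.
    have [xy|/ltW yx] := leP x y.
    + rewrite (@ger0_norm _ (y - x)) ?subr_ge0//.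
      rewrite (@ger0_norm _ (Phi y - _)) ?subr_ge0 ?Phi_nd//.
      apply: absorb => // z /andP[xz zy]; apply: Cqw.
      by move: yr1; rewrite !(distrC x) !ger0_norm ?subr_ge0//; lra.
    + rewrite distrC (distrC (I y)) (distrC (Phi y)).
      rewrite (@ger0_norm _ (x - y)) ?subr_ge0//.
      rewrite (@ger0_norm _ (Phi x - _)) ?subr_ge0 ?Phi_nd//.
      apply: absorb => // z /andP[yz zx]; apply: Cqw.
      by move: yr1; rewrite !ger0_norm ?subr_ge0//; lra.
  - move=> /not_orP[/contrapT px /not_orP[xa xb']].
    have {}ax : a < x by rewrite lt_neqAle ax andbT; apply/eqP => /esym.
    have {}xb : x < b by rewrite lt_neqAle xb andbT; apply/eqP.
    have [|dI I'] := FTC1_lebesgue_pt xb intpab _ px.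
      by rewrite /= lte_fin.
    have dH : is_derive x 1 H 0.
      have -> : 0 = f x - p x by rewrite pE ?subrr.
      apply: is_deriveB; first exact: dF.
      by split; [exact: dI | rewrite -derive1E I'].
    apply: filterS (is_derive_near_le dH e0) => y.
    rewrite mul0r subr0 => /le_trans + _; apply.
    by rewrite ler_pM2l// lerDl.
(* s is a sign, so that both H and - H are treated at once *)
have H_le e (s : R) : 0 < e -> `|s| = 1 ->
    s * (H b - H a) <= e * (b - a + (Phi b - Phi a)).
  move=> e0 s1.
  suff : e * (a + Phi a) - s * H a <= e * (b + Phi b) - s * H b by lra.
  apply: (@locally_increasing_le _ (fun x => e * (x + Phi x) - s * H x)); first exact: ltW.
  move=> x /[dup] xab /andP[ax xb]; apply: filterS (near_H e x e0 xab).
  move=> y Hyx /[dup] yab /andP[ay yb]; move: (Hyx yab) => {}Hyx.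
  have sH u v : s * (H v - H u) <= `|H v - H u|.
    by apply: le_trans (ler_norm _) _; rewrite normrM s1 mul1r.
  split=> [xy|yx].
  - move: Hyx (sH x y); rewrite (@ger0_norm _ (y - x)) ?subr_ge0//.
    by rewrite (@ger0_norm _ (Phi y - _)) ?subr_ge0 ?Phi_nd//; lra.
  - move: Hyx (sH y x); rewrite distrC (distrC y) (distrC (Phi y)).
    rewrite (@ger0_norm _ (x - y)) ?subr_ge0//.
    by rewrite (@ger0_norm _ (Phi x - _)) ?subr_ge0 ?Phi_nd//; lra.
have Ia0 : I a = 0 by rewrite /I set_itv1 Rintegral_set1.
have H0 : H b - H a = 0.
  apply/eqP/negPn/negP => D0.
  have K0 : 0 < b - a + (Phi b - Phi a).
    by have := Phi_nd a b (lexx a) (ltW ab); lra.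
  pose e := `|H b - H a| / (2 * (b - a + (Phi b - Phi a))).
  have e0 : 0 < e by rewrite divr_gt0 ?normr_gt0 ?mulr_gt0.
  have := H_le e (Num.sg (H b - H a)) e0.
  rewrite normr_sg D0 => /(_ erefl); rewrite -normrEsg.
  have -> : e * (b - a + (Phi b - Phi a)) = `|H b - H a| / 2.
    by rewrite /e; field; rewrite gt_eqF.
  have : 0 < `|H b - H a| by rewrite normr_gt0.
  lra.
have -> : \int[lebesgue_measure]_(x in `[a, b]) f x = I b.
  by apply: eq_Rintegral => x; rewrite inE/= in_itv/= => xab; rewrite pE.
by move: H0; rewrite /H Ia0; lra.
Qed.

(** * The trapezoidal error *)

Lemma Rintegral_mul_onem (R : realType) :
  \int[@lebesgue_measure R]_(t in `[0, 1]) (t * (1 - t)) = 1 / 6.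
Proof.
have dF (t : R) : 0 <= t <= 1 ->
    is_derive t 1 (fun t : R => t ^+ 2 / 2 - t ^+ 3 / 3) (t * (1 - t)).
  by move=> _; apply: is_derive_eq; rewrite /GRing.scale/=; field.
rewrite (Rintegral_derivative ltr01 dF); first by field.
apply: continuous_compact_integrable; first exact: segment_compact.
apply: continuous_subspaceT => x; apply: cvgM; first exact: cvg_id.
by apply: cvgB; [exact: cvg_cst | exact: cvg_id].
Qed.

Lemma integrable_parabola_mul (R : realType) (g : R -> R) (a b : R) :
  (@lebesgue_measure R).-integrable `[a, b] (EFin \o g) ->
  (@lebesgue_measure R).-integrable `[a, b]
    (EFin \o (fun x => (x - a) * (b - x) * g x)).
Proof.
move=> ig.
have mab : measurable (`[a, b] : set (measurableTypeR R)) by exact: measurable_itv.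
apply: (le_integrable mab _ _ (integrableZl mab ((b - a) ^+ 2) ig)).
- apply/measurable_EFinP; apply: measurable_funM.
    by apply: measurable_funM; exact: measurable_funB.
  by apply/measurable_EFinP; exact: measurable_int ig.
- move=> x /=; rewrite in_itv/= => /andP[ax xb].
  rewrite lee_fin !normrM ler_wpM2r//.
  by rewrite -normrM !ger0_norm; nra.
Qed.

(** The primitive [(x - a) * (b - x) * f1 x - (a + b - 2 * x) * f x] has
    derivative [(x - a) * (b - x) * f2 x + 2 * f x] and boundary values
    [(b - a) * f b] and [- (b - a) * f a], so that a single application of the
    fundamental theorem replaces two integrations by parts. *)
Lemma trapezoid_error_eq (R : realType) (f f1 f2 : R -> R) (a b : R) : a < b ->
  (forall x : R, a <= x <= b -> is_derive x 1 f (f1 x)) ->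
  (forall x : R, a <= x <= b -> is_derive x 1 f1 (f2 x)) ->
  (@lebesgue_measure R).-integrable `[a, b] (EFin \o f2) ->
  (f a + f b) / 2 - (b - a)^-1 * \int[@lebesgue_measure R]_(x in `[a, b]) f x =
  (2 * (b - a))^-1 *
    \int[@lebesgue_measure R]_(x in `[a, b]) ((x - a) * (b - x) * f2 x).
Proof.
move=> ab df df1 if2.
have ba0 : b - a != 0 by rewrite subr_eq0 gt_eqF.
have mab : measurable (`[a, b] : set (measurableTypeR R)) by exact: measurable_itv.
have if_ : (@lebesgue_measure R).-integrable `[a, b] (EFin \o f).
  apply: continuous_compact_integrable; first exact: segment_compact.
  apply: derivable_within_continuous => x; rewrite in_itv/= => xab.
  by have [] := df x xab.
have iKf2 := integrable_parabola_mul if2.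
pose G x := (x - a) * (b - x) * f1 x - (a + b - 2 * x) * f x.
have dG (x : R) : a <= x <= b ->
    is_derive x 1 G ((x - a) * (b - x) * f2 x + 2 * f x).
  move=> xab; have ? := df _ xab; have ? := df1 _ xab.
  by rewrite /G; apply: is_derive_eq; rewrite /GRing.scale/=; ring.
have i2f : (@lebesgue_measure R).-integrable `[a, b] (EFin \o (fun x => 2 * f x)).
  by have := integrableZl mab 2 if_.
have := Rintegral_derivative ab dG (integrableD mab iKf2 i2f).
rewrite RintegralD// RintegralZl// /G => E.
have -> : \int[lebesgue_measure]_(x in `[a, b]) ((x - a) * (b - x) * f2 x) =
   (b - a) * (f a + f b) - 2 * \int[lebesgue_measure]_(x in `[a, b]) f x by lra.
by field.
Qed.

Lemma measurable_parabola_segment (R : realType) (g : R -> R) (a b : R) :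
  a < b -> measurable_fun `[a, b] g ->
  measurable_fun (`[0, 1] : set R)
    (fun t : R => t * (1 - t) * `|g (t * a + (1 - t) * b)|).
Proof.
move=> ab mg; apply: measurable_funM.
  by apply: measurable_funM => //; exact: measurable_funB.
apply: measurableT_comp => //.
apply: (@measurable_comp _ _ _ _ _ _ `[a, b]%classic) => //.
  move=> _ [t /=] + <-; rewrite !in_itv/= => /andP[t0 t1].
  by apply/andP; split; nra.
apply: measurable_funD; first exact: measurable_funM.
by apply: measurable_funM => //; exact: measurable_funB.
Qed.

Lemma trapezoid_error_le (R : realType) (f f1 f2 : R -> R) (a b : R) : a < b ->
  (forall x : R, a <= x <= b -> is_derive x 1 f (f1 x)) ->
  (forall x : R, a <= x <= b -> is_derive x 1 f1 (f2 x)) ->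
  (@lebesgue_measure R).-integrable `[a, b] (EFin \o f2) ->
  (`|(f a + f b) / 2 - (b - a)^-1 * \int[@lebesgue_measure R]_(x in `[a, b]) f x|%:E
   <= ((b - a) ^+ 2 / 2)%:E * \int[@lebesgue_measure R]_(t in `[0%R, 1%R])
        (t * (1 - t) * `|f2 (t * a + (1 - t) * b)|)%:E)%E.
Proof.
move=> ab df df1 if2.
have ba0 : 0 < b - a by rewrite subr_gt0.
have iKf2 := integrable_parabola_mul if2.
have mf2 : measurable_fun `[a, b] f2.
  by apply/measurable_EFinP; exact: measurable_int if2.
rewrite (trapezoid_error_eq ab df df1 if2) normrM gtr0_norm ?invr_gt0 ?mulr_gt0//.
apply: (@le_trans _ _ ((2 * (b - a))^-1%:E *
   \int[lebesgue_measure]_(x in `[a, b]) `|(x - a) * (b - x) * f2 x|%:E)%E).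
  rewrite EFinM lee_pmul2l// ?lte_fin ?invr_gt0 ?mulr_gt0//.
  have iaKf2 := integrable_abse iKf2.
  have mab : measurable (`[a, b] : set (measurableTypeR R)) by exact: measurable_itv.
  have := le_normr_Rintegral mab iKf2.
  rewrite -lee_fin => /le_trans; apply.
  by rewrite /Rintegral fineK//; exact: integrable_fin_num iaKf2.
rewrite ge0_integral_segment//; last first.
  apply/measurable_EFinP; apply: measurableT_comp => //.
  by apply/measurable_EFinP; exact: measurable_int iKf2.
have -> : (\int[lebesgue_measure]_(t in `[0%R, 1%R])
      `|(t * a + (1 - t) * b - a) * (b - (t * a + (1 - t) * b)) *
        f2 (t * a + (1 - t) * b)|%:E =
    \int[lebesgue_measure]_(t in `[0%R, 1%R])
      (((b - a) ^+ 2)%:E * (t * (1 - t) * `|f2 (t * a + (1 - t) * b)|)%:E))%E.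
  apply: eq_integral => t; rewrite inE/= in_itv/= => /andP[t0 t1].
  rewrite -EFinM; congr EFin; rewrite normrM mulrA; congr (_ * _).
  rewrite ger0_norm; first by ring.
  by apply: mulr_ge0; nra.
rewrite ge0_integralZl//; first last.
- by rewrite lee_fin sqr_ge0.
- move=> t /=; rewrite in_itv/= => /andP[t0 t1].
  by rewrite lee_fin !mulr_ge0 ?subr_ge0.
- by apply/measurable_EFinP; exact: measurable_parabola_segment.
rewrite !muleA -!EFinM le_eqVlt; apply/orP; left; apply/eqP; congr (_%:E * _)%E.
by field; rewrite gt_eqF.
Qed.

(** Convexity enters only through a majorant of [|f2|] that is affine in an
    arbitrary nonnegative, possibly non-measurable, function [H]. *)
Lemma trapezoid_error_le_majorant (R : realType) (f f1 f2 H : R -> R)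
    (a b D C : R) : a < b ->
  (forall x : R, a <= x <= b -> is_derive x 1 f (f1 x)) ->
  (forall x : R, a <= x <= b -> is_derive x 1 f1 (f2 x)) ->
  (@lebesgue_measure R).-integrable `[a, b] (EFin \o f2) ->
  (forall t, 0 <= H t) -> 0 <= C ->
  (forall t, 0 < t < 1 -> `|f2 (t * a + (1 - t) * b)| <= D * H t + C) ->
  (`|(f a + f b) / 2 - (b - a)^-1 * \int[@lebesgue_measure R]_(x in `[a, b]) f x|%:E
   <= ((b - a) ^+ 2 / 2)%:E *
      (D%:E * \int[@lebesgue_measure R]_(t in `[0%R, 1%R]) (t * (1 - t) * H t)%:E
       + (C / 6)%:E))%E.
Proof.
move=> ab df df1 if2 H0 C0 f2H.
apply: le_trans (trapezoid_error_le ab df df1 if2) _.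
rewrite lee_pmul2l//; last by rewrite lte_fin divr_gt0// exprn_gt0// subr_gt0.
have m01 : measurable (`[0, 1] : set (measurableTypeR R)) by exact: measurable_itv.
have icont (c : R) : (@lebesgue_measure R).-integrable `[0%R, 1%R]
    (EFin \o (fun t : R => c * (t * (1 - t)))).
  apply: continuous_compact_integrable; first exact: segment_compact.
  apply: continuous_subspaceT => x; apply: cvgM; first exact: cvg_cst.
  apply: cvgM; first exact: cvg_id.
  by apply: cvgB; [exact: cvg_cst | exact: cvg_id].
have -> : ((C / 6)%:E = \int[@lebesgue_measure R]_(t in `[0%R, 1%R])
    (C * (t * (1 - t)))%:E)%E.
  rewrite -[RHS]fineK; last exact: integrable_fin_num (icont C).
  congr EFin; rewrite -[RHS]/(Rintegral _ _ _) RintegralZl//.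
    by rewrite Rintegral_mul_onem mul1r.
  have := icont 1; congr (_.-integrable _ _).
  by apply/funext => t /=; rewrite mul1r.
apply: integral_le_affine => //.
- apply: measurable_parabola_segment => //.
  by apply/measurable_EFinP; exact: measurable_int if2.
- move=> t /=; rewrite in_itv/= => /andP[t0 t1].
  by rewrite !mulr_ge0 ?subr_ge0.
- move=> t /=; rewrite in_itv/= => /andP[t0 t1].
  by rewrite !mulr_ge0 ?subr_ge0.
- move=> t /=; rewrite in_itv/= => /andP[t0 t1].
  by rewrite mulr_ge0// mulr_ge0 ?subr_ge0.
- move=> t /=; rewrite in_itv/= => /andP[].
  rewrite le_eqVlt => /predU1P[<- _|t0]; first by rewrite !mul0r !mulr0 add0r.
  rewrite le_eqVlt => /predU1P[->|t1].
    by rewrite subrr !mulr0 !mul0r !mulr0 addr0.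
  have tt : 0 <= t * (1 - t) by rewrite mulr_ge0 ?subr_ge0// ltW.
  have t01 : 0 < t < 1 by rewrite t0.
  by have := ler_wpM2l tt (f2H t t01); lra.
Qed.

Theorem theorem4 (R : realType)
  (J : set R) (h : R -> R)
  (hJ : `]0, 1[%classic `<=` J)
  (h_ge0 : forall t, J t -> 0 <= h t)
  (h_neq0 : exists2 t, J t & h t != 0)
  (alpha m : R) (halpha : 0 <= alpha <= 1) (hm : 0 <= m <= 1) (m_neq0 : m != 0)
  (I : set R) (hI : is_interval I)
  (f : R -> R) (hf : twice_differentiable_on I° f)
  (a b : R) (ha : I° a) (hb : I° b) (hbm : I° (b / m)) (hab : a < b)
  (hL1 : (@lebesgue_measure R).-integrable `[a, b] (EFin \o f^`(2)))
  (hconv : h_alpha_m_convex h alpha m (`[a, b]%classic `|` [set b / m])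
             (fun x => `|f^`(2) x|)) :
  (`| (f a + f b) / 2
      - (b - a)^-1 * \int[@lebesgue_measure R]_(x in `[a, b]) f x |%:E
   <= ((b - a) ^+ 2 / 2)%:E *
      ((`|f^`(2)%classic a| - m * `|f^`(2)%classic (b / m)|)%:E *
         \int[@lebesgue_measure R]_(t in `[0%R, 1%R])
            (t * (1 - t) * h t `^ alpha)%:E
       + (m / 6 * `|f^`(2)%classic (b / m)|)%:E))%E.
Proof.
have abI (x : R) : a <= x <= b -> I° x.
  move=> /andP[]; rewrite le_eqVlt => /predU1P[<-//|ax].
  rewrite le_eqVlt => /predU1P[->//|xb].
  have xab : x \in `]a, b[%R by rewrite in_itv/= ax.
  apply: filterS (near_in_itvoo xab) => y /=; rewrite in_itv/= => /andP[ay yb].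
  by apply: (hI a b (interior_subset ha) (interior_subset hb));
    rewrite (ltW ay) (ltW yb).
have df (x : R) : a <= x <= b -> is_derive x 1 f (f^`() x).
  by move=> /abI/hf[/derivableP + _]; rewrite -derive1E.
have df1 (x : R) : a <= x <= b -> is_derive x 1 f^`() (f^`(2) x).
  by move=> /abI/hf[_ /derivableP]; rewrite -derive1E.
have [_ conv] := hconv.
move: (f^`()) (f^`(2)) df df1 hL1 conv => f1 f2 df df1 if2 conv.
rewrite [m / 6 * _]mulrAC.
apply: (trapezoid_error_le_majorant (H := fun t => h t `^ alpha) hab df df1 if2).
- by move=> t; exact: powR_ge0.
- by rewrite mulr_ge0 ?normr_ge0//; case/andP: hm.
- move=> t t01.
  have Da : (`[a, b]%classic `|` [set b / m]) a.
    by left; rewrite /= in_itv/= lexx ltW.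
  have Db : (`[a, b]%classic `|` [set b / m]) (b / m) by right.
  have := conv a (b / m) t Da Db t01.
  have -> : m * (1 - t) * (b / m) = (1 - t) * b by field.
  by move=> /le_trans; apply; lra.
Qed.
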